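(* For every integer $a\geq 0$, the Segre-Veronese variety $SV^{(1,1,2)}_{(1,5a+3,1)}$ is $(6a+5)$-defective, and the Segre-Veronese variety $SV^{(1,1,2)}_{(1,5a+5,1)}$ is $(6a+7)$-defective.
   Context: All varieties are over $\mathbb{C}$. $SV^{(n_1,\dots,n_r)}_{(d_1,\dots,d_r)}\subseteq\mathbb{P}^N$, with $N=\prod_{i=1}^r\binom{n_i+d_i}{d_i}-1$, is the image of $\mathbb{P}^{n_1}\times\dots\times\mathbb{P}^{n_r}$ under the embedding induced by the complete linear system $|\mathcal{O}_{\mathbb{P}^{n_1}\times\dots\times\mathbb{P}^{n_r}}(d_1,\dots,d_r)|$. For an irreducible non-degenerate $n$-dimensional variety $X\subseteq\mathbb{P}^N$ and $h\geq 1$, the $h$-secant variety $\mathrm{Sec}_h(X)$ is the Zariski closure of the union of all linear spaces spanned by collections of $h$ points of $X$; its expected dimension is $\min\{nh+h-1,N\}$. $X$ is $h$-defective if $\dim \mathrm{Sec}_h(X)$ is strictly smaller than the expected dimension. *)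

(* Defs.v *)
From HB Require Import structures.
From mathcomp Require Import all_boot all_order all_algebra.
From mathcomp Require Import classical_sets reals complex mpoly.

Set Implicit Arguments.
Unset Strict Implicit.
Unset Printing Implicit Defensive.

Import GRing.Theory.
Local Open Scope classical_set_scope.
Local Open Scope ring_scope.

(* Points of P^N are the lines through the origin of F^(N+1). *)
Definition proj_space (F : fieldType) (N : nat) : Type :=
  {L : {vspace 'rV[F]_N.+1} | \dim L == 1}.

Definition vanishes_at (F : fieldType) (N : nat)
    (f : {mpoly F[N.+1]}) (p : proj_space F N) : Prop :=
  forall v : 'rV[F]_N.+1, v \in val p -> f.@[fun i => v 0 i] = 0.

Definition zariski_closed (F : fieldType) (N : nat)
    (Z : set (proj_space F N)) : Prop :=
  exists S : set {mpoly F[N.+1]},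
    (forall f, S f -> exists e : nat, f \is e.-homog) /\
    Z = [set p | forall f, S f -> vanishes_at f p].

Definition zariski_closure (F : fieldType) (N : nat)
    (A : set (proj_space F N)) : set (proj_space F N) :=
  [set p | forall Z, zariski_closed Z -> A `<=` Z -> Z p].

Definition irreducible_set (F : fieldType) (N : nat)
    (Z : set (proj_space F N)) : Prop :=
  Z !=set0 /\
  forall A B, zariski_closed A -> zariski_closed B ->
    Z `<=` A `|` B -> Z `<=` A \/ Z `<=` B.

(* A chain Z_0 < Z_1 < ... < Z_d of irreducible closed subsets of X, where
   closed refers to the subspace topology of X. *)
Definition irreducible_chain (F : fieldType) (N : nat)
    (X : set (proj_space F N)) (d : nat)
    (Z : nat -> set (proj_space F N)) : Prop :=
  (forall i, (i <= d)%N ->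
     irreducible_set (Z i) /\
     exists C, zariski_closed C /\ Z i = X `&` C) /\
  (forall i, (i < d)%N -> Z i `<` Z i.+1).

(* Krull dimension of X with the Zariski topology, as a relation: it holds
   for no d when X is empty. *)
Definition has_dim (F : fieldType) (N : nat)
    (X : set (proj_space F N)) (d : nat) : Prop :=
  (exists Z, irreducible_chain X d Z) /\
  (forall e Z, irreducible_chain X e Z -> (e <= d)%N).

Definition secant_variety (F : fieldType) (N h : nat)
    (X : set (proj_space F N)) : set (proj_space F N) :=
  zariski_closure
    [set p | exists q : 'I_h -> proj_space F N,
       (forall i, X (q i)) /\ (val p <= \sum_(i < h) val (q i))%VS].

Definition expected_secant_dim (n h N : nat) : nat :=
  minn (n * h + h - 1) N.

Definition defective (F : fieldType) (N h : nat)
    (X : set (proj_space F N)) : Prop :=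
  exists n s : nat,
    [/\ has_dim X n, has_dim (secant_variety h X) s
      & (s < expected_secant_dim n h N)%N].

(* Exponents of the monomials of degree d in n + 1 variables. *)
Definition monomial (n d : nat) : finType :=
  {t : n.+1.-tuple 'I_d.+1 | (\sum_(i <- t) i == d)%N}.

(* Exponents of the monomials of multidegree (d_1, ..., d_r); these monomials
   form a basis of the global sections of O(d_1, ..., d_r). *)
Definition multimonomial (r : nat) (n d : r.-tuple nat) : finType :=
  {dffun forall i : 'I_r, monomial (tnth n i) (tnth d i)}.

Definition sv_ambient_dim (r : nat) (n d : r.-tuple nat) : nat :=
  (\prod_(i < r) 'C(tnth n i + tnth d i, tnth d i) - 1)%N.

Lemma card_monomial (n d : nat) : #|monomial n d| = 'C(n + d, d).
Proof.
rewrite card_sig -(cardsE (fun t : n.+1.-tuple 'I_d.+1 => _)).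
by rewrite card_ord_partitions -bin_sub ?leq_addr // addKn.
Qed.

Lemma card_multimonomial (r : nat) (n d : r.-tuple nat) :
  (sv_ambient_dim n d).+1 = #|multimonomial n d|.
Proof.
rewrite card_dep_ffun foldrE big_map big_enum /= /sv_ambient_dim subn1.
under [in RHS]eq_bigr do rewrite card_monomial.
by rewrite prednK // prodn_gt0 // => i; rewrite bin_gt0 leq_addl.
Qed.

Definition sv_coord (r : nat) (n d : r.-tuple nat)
    (k : 'I_(sv_ambient_dim n d).+1) : multimonomial n d :=
  enum_val (cast_ord (card_multimonomial n d) k).

(* Homogeneous coordinates of the image of ([u_1], ..., [u_r]): the values at
   (u_1, ..., u_r) of all monomials of multidegree (d_1, ..., d_r). *)
Definition sv_map (F : fieldType) (r : nat) (n d : r.-tuple nat)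
    (u : forall i : 'I_r, 'rV[F]_(tnth n i).+1) :
    'rV[F]_(sv_ambient_dim n d).+1 :=
  \row_k \prod_(i < r) \prod_(j < (tnth n i).+1)
    u i 0 j ^+ tnth (val (sv_coord k i)) j.

Definition segre_veronese (F : fieldType) (r : nat) (n d : r.-tuple nat) :
    set (proj_space F (sv_ambient_dim n d)) :=
  [set p | exists u : forall i : 'I_r, 'rV[F]_(tnth n i).+1,
     (forall i, u i != 0) /\ val p = <[sv_map d u]>%VS].
Arguments segre_veronese F {r} n d.

(* Main.v *)
Require Import Defs.
From HB Require Import structures.
From mathcomp Require Import all_boot all_order all_algebra.
From mathcomp Require Import boolp classical_sets reals complex mpoly.
From mathcomp Require Import zify ring.
Set Implicit Arguments.
Unset Strict Implicit.
Unset Printing Implicit Defensive.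
Import GRing.Theory Num.Theory.
Local Open Scope classical_set_scope.
Local Open Scope ring_scope.

(** Put k = 3a+2, l = 2a+1 in the first case and k = 3a+3, l = 2a+2 in the
    second, so that the middle degree is e = k+l and the number of points is
    h = 2k+1.  A point of the secant variety is (in the closure of) a tensor
    T(i,s,j), i < 2, s <= e, j < 3, that is a sum of h terms
    c x_i y_0^(e-s) y_1^s z_j.  Through h = 2k+1 points of P^1 x P^1 there is a
    curve of bidegree (1,k), because such curves have 2k+2 coefficients; so
    there is a nonzero x(i,b), i < 2, b <= k, such that
         sum_(i,b) x(i,b) T(i,b+c,j) = 0    for all c <= l and all j
    ([rank_one_sum_syzygy]).  The last nonzero coefficient x(i0,b0) of one of
    the two rows may be taken to be 1, and then the relation expresses
    T(i0,s,j) for b0 <= s <= b0+l recursively through the other entries.  Hence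
    T depends polynomially on 2k+1 coefficients x and linearly on
    3(e+1) + 3k entries, which leaves a projective dimension of at most
         (2k+1) + (3(e+1)+3k) - 1 = 3e+5k+3    ([secant_chain_length_le]).
    This is 30a+22, respectively 30a+33, one less than the expected dimension.

    Krull dimension is related to the number of parameters by counting forms.
    On one hand, each step of a chain of irreducible sets raises by one the
    order of growth of the number of independent forms of degree t: if f
    vanishes on Q but not on the larger set P, then f times the independent
    forms on P together with those on Q stay independent on P
    ([indep_mod_add]).  So a chain of length e carries at least about t^e
    independent forms ([chain_indep]).  On the other hand, the forms of degree t
    in functions that are polynomial in q parameters and linear in r others are
    spanned by about t^(q+r-1) monomials ([card_bigraded_index]).  Comparing
    the two gives [chain_length_le].  The finitely many choices of (i0,b0) only
    multiply the number of spanning monomials by a constant.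

    Finally the Segre-Veronese variety has dimension at least 4, which makes the
    expected dimension as large as claimed: letting coordinates of the factors
    vanish one after the other gives a chain of irreducible closed subsets
    ([segre_veronese_chain]), irreducible because two points of such a subset
    are joined by a curve with polynomial parametrization. *)

(** * Linear relations and powers *)

Lemma leq_exp_base (e m n : nat) : (m <= n)%N -> (m ^ e <= n ^ e)%N.
Proof. by case: e => [|e] // mn; rewrite leq_exp2r. Qed.

Lemma nonzero_entry (F : fieldType) m (x : 'rV[F]_m) :
  x != 0 -> exists j, x 0 j != 0.
Proof.
move=> x0; apply/existsP; apply: contraNT x0 => /existsPn h.
by apply/eqP/rowP => k; rewrite mxE; apply/eqP; have := h k; rewrite negbK.
Qed.

(** More unknowns than equations: the form in which linear algebra enters, both
    for the curve through the h points and for the count of forms. *)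
Lemma exists_relation (F : fieldType) (I Y : finType) (A : I -> Y -> F) :
  (#|Y| < #|I|)%N ->
  exists x : I -> F, (exists i, x i != 0) /\ forall y, \sum_i x i * A i y = 0.
Proof.
move=> YI; pose M : 'M[F]_(#|I|, #|Y|) := \matrix_(i, j) A (enum_val i) (enum_val j).
have : kermx M != 0.
  by rewrite -mxrank_eq0 mxrank_ker subn_eq0 -ltnNge (leq_ltn_trans (rank_leq_col M)).
case/rowV0Pn => v /sub_kermxP vM v0; exists (fun i => v 0 (enum_rank i)); split.
  by have [k vk] := nonzero_entry v0; exists (enum_val k); rewrite enum_valK.
move=> y; have := congr1 (fun w : 'rV_ _ => w 0 (enum_rank y)) vM.
rewrite !mxE => vMy; apply: etrans vMy; rewrite [RHS](reindex (@enum_rank I)) /=;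
  last by apply: onW_bij; apply: enum_rank_bij.
by apply: eq_bigr => i _; rewrite mxE !enum_rankK.
Qed.

(** * Forms on sets of projective points *)

Section Points.
Variables (F : fieldType) (N : nat).
Implicit Types (p : proj_space F N) (f g : {mpoly F[N.+1]}).
Implicit Types (Z X : set (proj_space F N)) (v : 'rV[F]_N.+1).

Lemma homog_scale f d v c : f \is d.-homog ->
  f.@[fun i => (c *: v) 0 i] = c ^+ d * f.@[fun i => v 0 i].
Proof.
move=> /dhomogP fd; rewrite !mevalE mulr_sumr; apply: eq_big_seq => m /fd /= md.
rewrite mulrCA; congr (_ * _).
under eq_bigr do rewrite mxE exprMn.
by rewrite big_split /= prodrXr -mdegE; congr (_ ^+ _ * _).
Qed.

Lemma proj_gen p : exists2 v, v != 0 & val p = <[v]>%VS.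
Proof.
case: p => L /= /eqP L1; exists (vpick L).
  by rewrite vpick0 -dimv_eq0 L1.
apply/esym/eqP; rewrite eqEdim -memvE memv_pick L1 dim_vline vpick0.
by rewrite -dimv_eq0 L1.
Qed.

Lemma line_dim1 v : v != 0 -> \dim <[v]>%VS == 1.
Proof. by move=> v0; rewrite dim_vline v0. Qed.

Definition point_of v (v0 : v != 0) : proj_space F N :=
  exist _ <[v]>%VS (line_dim1 v0).

Lemma vanishes_at_gen f d p v : f \is d.-homog -> val p = <[v]>%VS ->
  vanishes_at f p <-> f.@[fun i => v 0 i] = 0.
Proof.
move=> fd pv; split=> [|fv w]; first by apply; rewrite pv memv_line.
by rewrite pv => /vlineP[c ->]; rewrite (homog_scale _ _ fd) fv mulr0.
Qed.

Definition vanishes_on Z f : Prop := forall p, Z p -> vanishes_at f p.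

Lemma zero_locus_closed f d : f \is d.-homog ->
  zariski_closed [set p | vanishes_at f p].
Proof.
move=> fd; exists [set f]; split; first by move=> g ->; exists d.
by apply/seteqP; split=> p /= fp; [move=> g -> | apply: fp].
Qed.

(** The ideal of an irreducible set is prime, as far as forms are concerned:
    [Z] is covered by the zero loci of [f] and [g]. *)
Lemma irreducible_prime Z f g d e : irreducible_set Z ->
  f \is d.-homog -> g \is e.-homog -> vanishes_on Z (f * g) ->
  vanishes_on Z f \/ vanishes_on Z g.
Proof.
move=> [_ Zirr] fd ge fg.
have [] := Zirr _ _ (zero_locus_closed fd) (zero_locus_closed ge); last 2 first.
- by move=> h; left.
- by move=> h; right.
move=> p Zp /=; have [v v0 pv] := proj_gen p.
have vp : v \in val p by rewrite pv memv_line.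
move: (fg p Zp v vp); rewrite mevalM => /eqP; rewrite mulf_eq0 => /orP[] /eqP h; 
  [left|right].
  by apply/(vanishes_at_gen fd pv).
by apply/(vanishes_at_gen ge pv).
Qed.

(** A lower bound [r] for the value at [t] of the Hilbert function of [Z],
    stated by independent forms in order to avoid quotients of spaces of
    polynomials. *)
Definition indep_mod Z t r : Prop :=
  exists g : 'I_r -> {mpoly F[N.+1]}, (forall i, g i \is t.-homog) /\
    forall c : 'I_r -> F, vanishes_on Z (\sum_i c i *: g i) -> forall i, c i = 0.

Lemma indep_mod_le Z t r s : (r <= s)%N -> indep_mod Z t s -> indep_mod Z t r.
Proof.
move=> rs [g [gt gi]]; exists (fun i => g (widen_ord rs i)); split=> // c cZ i.
pose c' (j : 'I_s) := if insub (j : nat) is Some k then c k else 0.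
have c'E k : c' (widen_ord rs k) = c k by rewrite /c' /= valK.
rewrite -c'E; apply: gi => p Zp v pv; rewrite -[RHS](cZ p Zp v pv).
congr (_.@[_]); rewrite (bigID (fun j : 'I_s => (j < r)%N)) /=.
rewrite [X in _ + X]big1 ?addr0; last first.
  by move=> j jr; rewrite /c' insubN // scale0r.
under [RHS]eq_bigr do rewrite -c'E.
by rewrite (big_ord_narrow rs).
Qed.

Lemma indep_mod0 Z t : indep_mod Z t 0.
Proof. by exists (fun _ => 0); split=> [i|c _ []//]; apply: rpred0. Qed.

(** The inequality h_P(t+d) >= h_P(t) + h_Q(t+d) between Hilbert functions,
    coming from the sequence R/I(P) -> R/I(P) -> R/I(Q) whose first map is
    multiplication by [f]: a relation between the multiples [f * g j] and the
    forms [h j] restricts to [Q] as a relation between the [h j], and what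
    remains is divided by [f] because I(P) is prime. *)
Lemma indep_mod_add P Q f d t r s : irreducible_set P -> Q `<=` P ->
  f \is d.-homog -> vanishes_on Q f -> ~ vanishes_on P f ->
  indep_mod P t r -> indep_mod Q (t + d) s -> indep_mod P (t + d) (r + s).
Proof.
move=> Pirr QP fd fQ fP [g [gt gi]] [h [ht hi]].
exists (fun i => match split i with inl j => f * g j | inr j => h j end).
split=> [i|c].
  by case: (split i) => j //; rewrite addnC dhomogM.
rewrite big_split_ord /=.
under eq_bigr => i _ do rewrite -[lshift _ _]/(unsplit (inl i)) unsplitK.
under [X in _ + X]eq_bigr => i _ do rewrite -[rshift _ _]/(unsplit (inr i)) unsplitK.
under eq_bigr do rewrite scalerAr.
rewrite -mulr_sumr => cP.
have ch : forall i, c (rshift r i) = 0.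
  apply: hi => p Qp v pv.
  have := cP p (QP _ Qp) v pv.
  by rewrite mevalD mevalM (fQ p Qp v pv) mul0r add0r.
have cg : forall i, c (lshift s i) = 0.
  have Gt : \sum_i c (lshift s i) *: g i \is t.-homog.
    by apply: rpred_sum => i _; apply: rpredZ.
  apply: gi; case: (irreducible_prime Pirr fd Gt) => //.
  move: cP; rewrite [X in _ + X]big1 ?addr0 // => i _.
  by rewrite ch scale0r.
by move=> i; rewrite -(splitK i); case: (split i).
Qed.

(** Applying [indep_mod_add] [t] times turns growth of order [t ^ e] on [Q] into
    growth of order [t ^ e.+1] on [P].  Powers of [f] bring its degree to a
    multiple of [D]. *)
Lemma indep_mod_grow P Q f d D e : irreducible_set P -> Q `<=` P ->
  (0 < d)%N -> f \is d.-homog -> vanishes_on Q f -> ~ vanishes_on P f ->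
  (0 < D)%N -> (forall t, indep_mod Q (t * D) (t ^ e)) ->
  exists2 D', (0 < D')%N & forall t, indep_mod P (t * D') (t ^ e.+1).
Proof.
move=> Pirr QP d0 fd fQ fP D0 IH; exists (2 * (d * D))%N.
  by rewrite !muln_gt0 d0 D0.
move=> t.
have fDd : f ^+ D \is (d * D).-homog by apply: dhomogMn.
have fDQ : vanishes_on Q (f ^+ D).
  by move=> p Qp v pv; rewrite rmorphXn /= (fQ p Qp v pv) expr0n eqn0Ngt D0.
have fDP : ~ vanishes_on P (f ^+ D).
  move=> h; apply: fP => p Pp v pv; have := h p Pp v pv.
  by rewrite rmorphXn /= => /eqP; rewrite expf_eq0 D0 => /eqP.
(* start at degree t * (d * D), so that Q contributes at least t ^ e each time *)
suff H i : indep_mod P ((t + i) * (d * D)) (i * t ^ e).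
  by move: (H t); rewrite addnn -mul2n expnS -mulnA mulnCA.
elim: i => [|i IHi]; first exact: indep_mod0.
rewrite addnS !mulSn [(d * D + _)%N]addnC [(t ^ e + _)%N]addnC.
apply: (indep_mod_add Pirr QP fDd fDQ fDP IHi).
rewrite addnC -mulSn mulnA.
apply: indep_mod_le (IH _); apply: leq_exp_base.
by rewrite -addnS (leq_trans (leq_addr i.+1 t)) // leq_pmulr.
Qed.

(** The geometric half of the dimension count: the [i]-th member of a chain of
    irreducible sets has a Hilbert function of order at least [t ^ i]. *)
Lemma chain_indep X d (W : nat -> set (proj_space F N)) i :
  irreducible_chain X d W -> (i <= d)%N ->
  exists2 D, (0 < D)%N & forall t, indep_mod (W i) (t * D) (t ^ i).
Proof.
move=> [Zirr Zlt]; elim: i => [|i IH] id.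
  have [[[p Zp] _] _] := Zirr 0 id.
  have [v v0 pv] := proj_gen p.
  have [k vk] := nonzero_entry v0.
  exists 1%N => // t; rewrite expn0; exists (fun _ => 'X_k ^+ t); split=> [i|c].
    by rewrite -[(t * 1)%N]mulnC dhomogMn // dhomogX /= mdeg1.
  rewrite big_ord1 => /(_ p Zp v); rewrite pv memv_line => /(_ isT).
  rewrite mevalZ rmorphXn /= mevalXU => /eqP.
  rewrite mulf_eq0 expf_eq0 (negbTE vk) andbF orbF => /eqP c0 j.
  by rewrite ord1.
have [D D0 H] := IH (ltnW id).
have [Pirr _] := Zirr _ id.
have [[[q Zq] _] [C [[S [Sh ->]] ZC]]] := Zirr _ (ltnW id).
have [sub nsub] := Zlt _ id.
have [p [Zp Cp]] : exists p, W i.+1 p /\ ~ W i p.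
  apply: contrapT => h; apply: nsub => p Zp; apply: contrapT => nZ.
  by apply: h; exists p.
have Xp : X p by have [_ [C' [_ ZE]]] := Zirr _ id; move: Zp; rewrite ZE => -[].
have [f [Sf fp]] : exists f, S f /\ ~ vanishes_at f p.
  apply: contrapT => h; apply: Cp; rewrite ZC; split=> // f Sf.
  by apply: contrapT => nf; apply: h; exists f.
have fQ : vanishes_on (W i) f by move=> r; rewrite ZC => -[_]; apply.
have [e fe] := Sh _ Sf.
apply: (indep_mod_grow Pirr sub _ fe fQ _ D0 H); last by move/(_ p Zp).
(* a form of degree 0 that vanishes somewhere is zero *)
rewrite lt0n; apply/eqP => e0; apply: fp => v _; subst e.
have := homog_scale v 0 fe; rewrite expr0 mul1r => <-.
by rewrite scale0r; apply: (fQ q Zq); rewrite mem0v.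
Qed.

End Points.

(** * Functions spanned by bounded monomials *)

Section Bigraded.
Variables (F : fieldType) (T : Type) (Iu Iw : finType).
Variables (u : Iu -> T -> F) (w : Iw -> T -> F).

Definition bimonomial (b : Iu -> nat) (c : Iw -> nat) (x : T) : F :=
  \prod_i u i x ^+ b i * \prod_j w j x ^+ c j.

(** The span of the monomials that have degree at most [m] in each [u i] and
    degree exactly [n] in the [w j]; bounding the degree in each [u i] separately
    makes the monomials easy to count. *)
Inductive bigraded (m n : nat) : (T -> F) -> Prop :=
| bigraded_zero f : (forall x, f x = 0) -> bigraded m n f
| bigraded_cons a b c f g : (forall i, b i <= m)%N -> \sum_j c j = n ->
    bigraded m n g -> (forall x, f x = a * bimonomial b c x + g x) ->
    bigraded m n f.

Lemma bigraded_ext m n f g : (forall x, f x = g x) -> bigraded m n f ->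
  bigraded m n g.
Proof.
move=> fg H; case: H fg => [f' f0|a b c f' g' bm cn H fE] fg.
  by apply: bigraded_zero => x; rewrite -fg f0.
by apply: (bigraded_cons bm cn H) => x; rewrite -fg fE.
Qed.

Lemma bigraded_mon m n b c : (forall i, b i <= m)%N -> \sum_j c j = n ->
  bigraded m n (bimonomial b c).
Proof.
move=> bm cn.
apply: (@bigraded_cons _ _ 1 b c _ (fun _ => 0) bm cn); first exact: bigraded_zero.
by move=> x; rewrite mul1r addr0.
Qed.

Lemma bigradedD m n f g : bigraded m n f -> bigraded m n g ->
  bigraded m n (fun x => f x + g x).
Proof.
move=> H; elim: H g => [{}f f0 g|a b c {}f h bm cn _ IH fE g] Hg.
  by apply: bigraded_ext Hg => x; rewrite f0 add0r.
by apply: (bigraded_cons bm cn (IH g Hg)) => x; rewrite fE addrA.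
Qed.

Lemma bigraded_scale m n k f : bigraded m n f -> bigraded m n (fun x => k * f x).
Proof.
elim=> [{}f f0|a b c {}f g bm cn _ IH fE].
  by apply: bigraded_zero => x; rewrite f0 mulr0.
by apply: (bigraded_cons bm cn IH (a := k * a)) => x; rewrite fE mulrDr mulrA.
Qed.

Lemma bigradedN m n f : bigraded m n f -> bigraded m n (fun x => - f x).
Proof. by move/(bigraded_scale (-1)); apply: bigraded_ext => x; rewrite mulN1r. Qed.

Lemma bigraded_sum m n (J : Type) (r : seq J) (P : pred J) (f : J -> T -> F) :
  (forall j, P j -> bigraded m n (f j)) ->
  bigraded m n (fun x => \sum_(j <- r | P j) f j x).
Proof.
move=> H; elim: r => [|j r IH].
  by apply: bigraded_zero => x; rewrite big_nil.
case Pj: (P j); last by apply: bigraded_ext IH => x; rewrite big_cons Pj.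
by apply: bigraded_ext (bigradedD (H j Pj) IH) => x; rewrite big_cons Pj.
Qed.

Lemma bigraded_le m m' n f : (m <= m')%N -> bigraded m n f -> bigraded m' n f.
Proof.
move=> mm; elim=> [{}f f0|a b c {}f g bm cn _ IH fE].
  exact: bigraded_zero.
by apply: (bigraded_cons _ cn IH fE) => i; rewrite (leq_trans (bm i)).
Qed.

Lemma bigradedM m n m' n' f g : bigraded m n f -> bigraded m' n' g ->
  bigraded (m + m') (n + n') (fun x => f x * g x).
Proof.
move=> Hf Hg.
have Hm b c : (forall i, b i <= m)%N -> \sum_j c j = n ->
    bigraded (m + m') (n + n') (fun x => bimonomial b c x * g x).
  move=> bm cn; elim: Hg => [{}g g0|a' b' c' {}g h' bm' cn' _ IH gE].
    by apply: bigraded_zero => x; rewrite g0 mulr0.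
  apply: (@bigraded_cons _ _ a' (fun i => b i + b' i)%N (fun j => c j + c' j)%N
    _ _ _ _ IH).
  - by move=> i; rewrite leq_add.
  - by rewrite big_split cn cn'.
  move=> x; rewrite gE mulrDr; congr (_ + _); rewrite mulrCA; congr (_ * _).
  rewrite /bimonomial mulrACA -!big_split.
  by congr (_ * _); apply: eq_bigr => i _; rewrite exprD.
elim: Hf => [{}f f0|a b c {}f h bm cn _ IH fE].
  by apply: bigraded_zero => x; rewrite f0 mul0r.
apply: bigraded_ext (bigradedD (bigraded_scale a (Hm b c bm cn)) IH) => x.
by rewrite fE mulrDl mulrA.
Qed.

Lemma bigraded1 m : bigraded m 0 (fun _ => 1).
Proof.
apply: bigraded_ext (@bigraded_mon m 0 (fun _ => 0%N) (fun _ => 0%N) _ _) => //.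
  by move=> x; rewrite /bimonomial !big1 ?mulr1.
by rewrite big1.
Qed.

Lemma bigraded_u m i : (0 < m)%N -> bigraded m 0 (u i).
Proof.
move=> m0; apply: bigraded_ext
  (@bigraded_mon m 0 (fun j => (j == i) : nat) (fun _ => 0%N) _ _).
- move=> x; rewrite /bimonomial [X in _ * X]big1 // mulr1 (bigD1 i) //= eqxx.
  by rewrite big1 ?mulr1 ?expr1 // => j /negbTE->.
- by move=> j; case: (j == i).
- by rewrite big1.
Qed.

Lemma bigraded_w m j : bigraded m 1 (w j).
Proof.
apply: bigraded_ext
  (@bigraded_mon m 1 (fun _ => 0%N) (fun i => (i == j) : nat) _ _) => //.
- move=> x; rewrite /bimonomial big1 // mul1r (bigD1 j) //= eqxx.
  by rewrite big1 ?mulr1 ?expr1 // => i /negbTE->.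
- by rewrite (bigD1 j) //= eqxx big1 // => i /negbTE->.
Qed.

Lemma bigradedX m n f k : bigraded m n f ->
  bigraded (k * m) (k * n) (fun x => f x ^+ k).
Proof.
move=> H; elim: k => [|k IH]; first exact: bigraded_ext (bigraded1 _).
by rewrite !mulSn; apply: bigraded_ext (bigradedM H IH) => x; rewrite exprS.
Qed.

Lemma bigraded_prod (J : Type) (r : seq J) (m n : J -> nat) (f : J -> T -> F) :
  (forall j, bigraded (m j) (n j) (f j)) ->
  bigraded (\sum_(j <- r) m j) (\sum_(j <- r) n j)
    (fun x => \prod_(j <- r) f j x).
Proof.
move=> H; elim: r => [|j r IH].
  by rewrite !big_nil; apply: bigraded_ext (bigraded1 _) => x; rewrite big_nil.
by rewrite !big_cons; apply: bigraded_ext (bigradedM (H j) IH) => x; rewrite big_cons.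
Qed.

(** If the coordinates of [phi] have degree 1 in the [w j], then a form of degree
    [t] pulls back to a function of degree [t] in the [w j]. *)
Lemma bigraded_form N (D t : nat) (phi : T -> 'rV[F]_N.+1) (g : {mpoly F[N.+1]}) :
  (forall k, bigraded D 1 (fun x => phi x 0 k)) -> g \is t.-homog ->
  bigraded (t * D) t (fun x => g.@[fun i => phi x 0 i]).
Proof.
move=> H /dhomogP gt.
apply: (@bigraded_ext _ _ (fun x => \sum_(m <- msupp g | m \in msupp g)
    g@_m * \prod_i phi x 0 i ^+ m i)).
  by move=> x; rewrite mevalE [RHS]big_seq_cond; apply: eq_bigl => m; rewrite andbT.
apply: bigraded_sum => m /gt /= mt; apply: bigraded_scale.
have := bigraded_prod (index_enum 'I_N.+1) (fun i => bigradedX (m i) (H i)).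
by rewrite -big_distrl -big_distrl /= muln1 -mdegE mt.
Qed.

Definition bigraded_index m n : finType :=
  ({ffun Iu -> 'I_m.+1} * {c : {ffun Iw -> 'I_n.+1} | \sum_j (c j : nat) == n})%type.

Definition bigraded_basis m n (y : bigraded_index m n) : T -> F :=
  bimonomial (fun i => y.1 i) (fun j => val y.2 j).

Lemma bigraded_span m n f : bigraded m n f ->
  exists c : bigraded_index m n -> F,
    forall x, f x = \sum_y c y * bigraded_basis y x.
Proof.
elim=> [{}f f0|a b c {}f g bm cn _ [k gE] fE].
  by exists (fun _ => 0) => x; rewrite f0 big1 // => y _; rewrite mul0r.
pose c' : {ffun Iw -> 'I_n.+1} := [ffun j => inord (c j)].
have c'E j : c' j = c j :> nat.
  by rewrite ffunE inordK // ltnS -cn (bigD1 j) //= leq_addr.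
have c'n : \sum_j (c' j : nat) == n by rewrite (eq_bigr _ (fun j _ => c'E j)) cn.
pose y0 : bigraded_index m n := ([ffun i => inord (b i)], Sub c' c'n).
exists (fun y => a * (y == y0)%:R + k y) => x.
rewrite fE gE; under [RHS]eq_bigr do rewrite mulrDl.
rewrite big_split /=; congr (_ + _).
rewrite (bigD1 y0) //= eqxx mulr1 [X in _ + X]big1 ?addr0; last first.
  by move=> y /negbTE->; rewrite mulr0 mul0r.
congr (_ * (_ * _)); apply: eq_bigr => i _; last by rewrite /= c'E.
by rewrite /= ffunE inordK // ltnS.
Qed.

(** The exponent of one chosen [w j0] is determined by the other ones; this is
    where the passage from affine to projective dimension saves a factor. *)
Lemma card_bigraded_index m n : (0 < #|Iw|)%N ->
  (#|bigraded_index m n| <= m.+1 ^ #|Iu| * n.+1 ^ (#|Iw| - 1))%N.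
Proof.
case/card_gt0P => j0 _; rewrite card_prod card_ffun card_ord leq_mul2l.
apply/orP; right; rewrite card_sig.
pose S := pffun_on (ord0 : 'I_n.+1) (predC1 j0) predT.
have <- : #|S| = (n.+1 ^ (#|Iw| - 1))%N.
  by rewrite card_pffun_on card_ord cardC1 subn1.
pose h (c : {ffun Iw -> 'I_n.+1}) := [ffun j => if j == j0 then ord0 else c j].
rewrite -(card_in_image (f := h)); last first.
  move=> c1 c2; rewrite !inE => /eqP s1 /eqP s2 /ffunP h12.
  have e12 j : j != j0 -> c1 j = c2 j.
    by move=> /negbTE jj; have := h12 j; rewrite !ffunE jj.
  apply/ffunP => j; have [->|/e12//] := eqVneq j j0; apply: val_inj => /=.
  move: (etrans s1 (esym s2)); rewrite (bigD1 j0) //= [RHS](bigD1 j0) //=.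
  rewrite (eq_bigr (fun j => c2 j : nat)) => [/addIn //|i /e12 -> //].
apply: subset_leq_card; apply/fintype.subsetP => _ /fintype.imageP[c _ ->].
apply/pffun_onP; split=> //; apply/fintype.subsetP => j.
by rewrite !inE ffunE; case: ifP => //; rewrite eqxx.
Qed.

End Bigraded.

(** * Chains are no longer than the number of parameters *)

Section ChainBound.
Variables (F : fieldType) (N : nat) (X : set (proj_space F N)).
Variables (S : finType) (T : S -> Type) (phi : forall s, T s -> 'rV[F]_N.+1).
Variables (Iu Iw : finType) (u : forall s, Iu -> T s -> F).
Variables (w : forall s, Iw -> T s -> F) (D : nat).
Hypothesis Iw_gt0 : (0 < #|Iw|)%N.
Hypothesis phi_bigraded :
  forall s k, bigraded (@u s) (@w s) D 1 (fun x => phi x 0 k).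
Hypothesis phi_dense : forall t (g : {mpoly F[N.+1]}), g \is t.-homog ->
  (forall s (x : T s), g.@[fun i => phi x 0 i] = 0) -> vanishes_on X g.

(** On each of the [#|S|] pieces the forms of degree [t] lie in the span of the
    bounded monomials; if there were more independent forms than monomials on
    all pieces together, some combination would vanish on every piece. *)
Lemma indep_mod_bound Z t r : Z `<=` X -> indep_mod Z t r ->
  (r <= #|S| * ((t * D).+1 ^ #|Iu| * t.+1 ^ (#|Iw| - 1)))%N.
Proof.
move=> ZX [g [gt gi]].
apply: (@leq_trans (#|S| * #|bigraded_index Iu Iw (t * D) t|)); last first.
  by rewrite leq_mul2l card_bigraded_index ?orbT.
rewrite leqNgt; apply/negP => lt_r.
have /choice[c cE] : forall js : 'I_r * S, exists c, forall x : T js.2,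
    (g js.1).@[fun i => phi x 0 i] =
    \sum_y c y * bigraded_basis (m := t * D) (n := t) (@u js.2) (@w js.2) y x.
  by move=> [i s]; apply: bigraded_span; apply: bigraded_form.
have [|z [[i zi0] zE]] := @exists_relation F 'I_r
    (S * bigraded_index Iu Iw (t * D) t)%type (fun i sy => c (i, sy.1) sy.2).
  by rewrite card_prod card_ord.
have zg : \sum_i z i *: g i \is t.-homog by apply: rpred_sum => j _; apply: rpredZ.
move/eqP: zi0; apply; apply: gi => p Zp; apply: (phi_dense zg) (ZX _ Zp).
move=> s x; rewrite raddf_sum /=.
under eq_bigr => j _ do rewrite mevalZ (cE (j, s)) mulr_sumr /=.
rewrite exchange_big big1 //= => y _.
under eq_bigr do rewrite mulrA.
by rewrite -mulr_suml (zE (s, y)) mul0r.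
Qed.

(** Let the coordinates of finitely many families of points be polynomial in the
    [#|Iu|] functions [u] and linear in the [#|Iw|] functions [w].  If forms
    vanishing on the families vanish on [X], then [X] has dimension at most
    [#|Iu| + #|Iw| - 1]: otherwise its Hilbert function would grow faster than
    the number of available monomials. *)
Theorem chain_length_le e W : irreducible_chain X e W ->
  (e <= #|Iu| + (#|Iw| - 1))%N.
Proof.
move=> chW; have [D' D'0 H] := chain_indep chW (leqnn e).
have WX : W e `<=` X.
  by case: chW => /(_ e (leqnn e))[_ [C [_ ->]]] _ p [].
rewrite leqNgt; apply/negP; set E := (_ + _)%N => lt_e.
(* there are at most K * t ^ E monomials in degree t * D', against t ^ e
   independent forms; this fails for t = K + 1 *)
have [K KE] : exists K, K = (#|S| * ((D' * D).+1 ^ #|Iu| * D'.+1 ^ (#|Iw| - 1)))%N.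
  by eexists.
have := indep_mod_bound WX (H K.+1); apply/negP; rewrite -ltnNge.
have mulS m : ((K.+1 * m).+1 <= K.+1 * m.+1)%N by rewrite mulnS addSn ltnS leq_addl.
apply: (@leq_ltn_trans (K * K.+1 ^ E)); last first.
  apply: (@leq_trans (K.+1 ^ E.+1)); last by rewrite leq_pexp2l.
  by rewrite expnS ltn_mul2r expn_gt0 ltnSn.
rewrite {lt_e}/E expnD [X in (_ <= X * _)%N]KE.
rewrite -!mulnA leq_mul2l [X in (_ <= X)%N]mulnA mulnACA -!expnMn.
rewrite ![(_.+1 * K.+1)%N]mulnC; apply/orP; right.
by apply: leq_mul; apply: leq_exp_base.
Qed.

End ChainBound.

(** * Existence of the dimension *)

Section Dimension.
Variables (F : fieldType) (N : nat).
Implicit Types (X : set (proj_space F N)).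

Lemma point_closed (p : proj_space F N) : zariski_closed [set p].
Proof.
have [v v0 pv] := proj_gen p.
pose e (ij : 'I_N.+1 * 'I_N.+1) : {mpoly F[N.+1]} :=
  v 0 ij.1 *: 'X_ij.2 - v 0 ij.2 *: 'X_ij.1.
have eh ij : e ij \is 1.-homog.
  by apply: rpredB; apply: rpredZ; rewrite dhomogX /= mdeg1.
exists [set e ij | ij in setT]; split=> [f [ij _ <-]|]; first by exists 1%N.
apply/seteqP; split=> [_ -> f [[i j] _ <-] x|q /= H].
  rewrite pv => /vlineP[c ->].
  by rewrite mevalB !mevalZ !mevalXU !mxE /= mulrCA [X in _ - X]mulrCA
    [v 0 j * _]mulrC subrr.
have [k vk] := nonzero_entry v0.
apply: val_inj; rewrite pv.
have [x x0 qx] := proj_gen q; apply/eqP.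
rewrite eqEdim qx !dim_vline v0 x0 leqnn andbT -memvE; apply/vlineP.
exists (x 0 k / v 0 k); apply/rowP => j.
have := H (e (k, j)) (ex_intro2 _ _ _ I erefl) x.
rewrite qx memv_line => /(_ isT).
rewrite mevalB !mevalZ !mevalXU /= => /eqP; rewrite subr_eq0 => /eqP E.
by rewrite mxE mulrAC [x 0 k * _]mulrC -E mulrAC mulfV // mul1r.
Qed.

(** Points are closed, so a nonempty set has a chain of length 0; among the chains
    of bounded length there is a longest one. *)
Lemma has_dim_exists X b : X !=set0 ->
  (forall e W, irreducible_chain X e W -> (e <= b)%N) ->
  exists2 d, has_dim X d & (d <= b)%N.
Proof.
move=> [p Xp] Xb.
pose P e := `[< exists W, irreducible_chain X e W >].
have P0 : exists e, P e.
  exists 0%N; apply/asboolP; exists (fun _ => [set p]); split=> // i _; split.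
    split; first by exists p.
    by move=> A B _ _ h; have [] := h p erefl => hp; [left|right] => _ ->.
  exists [set p]; split; first exact: point_closed.
  by apply/seteqP; split=> q /= => [->|[]].
have Pb e : P e -> (e <= b)%N by move=> /asboolP[W]; apply: Xb.
case: (ex_maxnP P0 Pb) => d /asboolP Pd dmax.
exists d; last by apply: Pb; apply/asboolP.
by split=> // e W he; apply: dmax; apply/asboolP; exists W.
Qed.

(** The coordinates themselves serve as linear parameters. *)
Lemma chain_length_le_ambient X e W : irreducible_chain X e W -> (e <= N)%N.
Proof.
have := @chain_length_le F N X unit (fun _ => 'rV[F]_N.+1) (fun _ v => v)
  void 'I_N.+1 (fun _ i _ => match i with end) (fun _ k v => v 0 k) 0.
rewrite card_void card_ord subn1; apply=> //.
  by move=> s k; apply: bigraded_w.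
by move=> t g _ g0 p _ v _; apply: (g0 tt).
Qed.

End Dimension.


(** * Segre-Veronese varieties and their coordinate subvarieties *)

Lemma poly_nonroot (F : numFieldType) (h : {poly F}) : h != 0 ->
  exists x, h.[x] != 0.
Proof.
move=> h0; apply: contrapT => H.
have := @max_poly_roots F h [seq i%:R | i <- iota 0 (size h)] h0.
rewrite size_map size_iota ltnn => Hr; suff: false by [].
apply: Hr.
  apply/allP => _ /mapP[i _ ->]; rewrite /root; apply: contrapT => /negP hi.
  by apply: H; exists i%:R.
by rewrite map_inj_uniq ?iota_uniq // => i j /eqP; rewrite eqr_nat => /eqP.
Qed.

Section SegreVeronese.
Variables (F : numFieldType) (r : nat) (n d : r.-tuple nat).
Hypothesis d_gt0 : forall i, (0 < tnth d i)%N.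
Local Notation N := (sv_ambient_dim n d).
Let point := forall i : 'I_r, 'rV[F]_(tnth n i).+1.
Implicit Types (u : point).

Lemma monomial_sum m e (t : monomial m e) : (\sum_(j < m.+1) tnth (val t) j = e)%N.
Proof. by case: t => t /= /eqP te; apply: etrans te; rewrite big_tuple. Qed.

Lemma pure_monomial m e (j : 'I_m.+1) :
  exists t : monomial m e, forall i, tnth (val t) i = (if i == j then e else 0)%N :> nat.
Proof.
pose t := [tuple (if i == j then ord_max else ord0 : 'I_e.+1) | i < m.+1].
have te : (\sum_(i <- t) i == e)%N.
  rewrite big_tuple (bigD1 j) //= big1 => [|i /negbTE ij]; rewrite tnth_mktuple ?ij //.
  by rewrite eqxx addn0.
exists (Sub t te) => i; rewrite SubK tnth_mktuple.
by case: (i == j).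
Qed.

Lemma sv_coord_surj (mu : multimonomial n d) : exists k, sv_coord k = mu.
Proof.
exists (cast_ord (esym (card_multimonomial n d)) (enum_rank mu)).
by rewrite /sv_coord cast_ordKV enum_rankK.
Qed.

(** Monomials that are powers of a single variable in each group detect which
    coordinates of the factors vanish. *)
Lemma sv_coord_pure (j : forall i : 'I_r, 'I_(tnth n i).+1) :
  exists k : 'I_N.+1, forall i l,
    tnth (val (sv_coord k i)) l = (if l == j i then tnth d i else 0)%N :> nat.
Proof.
pose mu : multimonomial n d :=
  [ffun i => sval (cid (pure_monomial (tnth d i) (j i)))].
have [k kE] := sv_coord_surj mu; exists k => i l.
by rewrite kE ffunE (svalP (cid (pure_monomial (tnth d i) (j i)))).
Qed.

Lemma sv_map_pure u (j : forall i : 'I_r, 'I_(tnth n i).+1)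
    (k : 'I_N.+1) :
  (forall i l, tnth (val (sv_coord k i)) l = (if l == j i then tnth d i else 0)%N :> nat) ->
  sv_map d u 0 k = \prod_i u i 0 (j i) ^+ tnth d i.
Proof.
move=> kE; rewrite mxE; apply: eq_bigr => i _.
rewrite (bigD1 (j i)) //= kE eqxx big1 ?mulr1 // => l /negbTE lj.
by rewrite kE lj.
Qed.

Lemma sv_map_eq0 u : (sv_map d u == 0) = [exists i, u i == 0].
Proof.
apply/idP/idP; last first.
  case/existsP => i /eqP ui; apply/eqP/rowP => k; rewrite !mxE.
  apply/eqP/prodf_eq0; exists i => //.
  have /existsP[l tl] : [exists l, (0 < tnth (val (sv_coord k i)) l)%N].
    have := d_gt0 i; apply: contraLR => /existsPn h.
    rewrite -(monomial_sum (sv_coord k i)) -eqn0Ngt sum_nat_eq0.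
    by apply/forallP => l; rewrite eqn0Ngt h.
  by apply/prodf_eq0; exists l => //; rewrite ui mxE expf_eq0 tl eqxx.
apply: contraTT => /existsPn u0.
have ex i : exists j, u i 0 j != 0 by apply: nonzero_entry.
have [k kE] := sv_coord_pure (fun i => xchoose (ex i)).
have : sv_map d u 0 k != 0.
  rewrite (sv_map_pure u kE); apply/prodf_neq0 => i _.
  by rewrite expf_neq0 // (xchooseP (ex i)).
by apply: contraNneq => ->; rewrite mxE.
Qed.

Lemma sv_map_neq0 u : (forall i, u i != 0) -> sv_map d u != 0.
Proof. by move=> u0; rewrite sv_map_eq0; apply/existsPn. Qed.

Lemma sv_coord_detects u i (j : 'I_(tnth n i).+1) :
  (forall i, u i != 0) -> u i 0 j != 0 ->
  exists k : 'I_N.+1, sv_map d u 0 k != 0 /\ (0 < tnth (val (sv_coord k i)) j)%N.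
Proof.
move=> u0 uij.
have ex i' : exists j' : 'I_(tnth n i').+1,
    u i' 0 j' != 0 /\ (i' = i -> j' = j :> nat).
  have [->|/eqP ii] := eqVneq i' i; first by exists j.
  by have [j' uj'] := nonzero_entry (u0 i'); exists j'.
pose J i' := sval (cid (ex i')).
have uJ i' : u i' 0 (J i') != 0 by have [] := svalP (cid (ex i')).
have Ji : J i = j by apply: val_inj; have [_ /(_ erefl)] := svalP (cid (ex i)).
have [k kE] := sv_coord_pure J; exists k; split.
  by rewrite (sv_map_pure u kE); apply/prodf_neq0 => i' _; rewrite expf_neq0.
by rewrite kE Ji eqxx.
Qed.

Lemma sv_map_coord0 u i (j : 'I_(tnth n i).+1) (k : 'I_N.+1) : u i 0 j = 0 ->
  (0 < tnth (val (sv_coord k i)) j)%N -> sv_map d u 0 k = 0.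
Proof.
move=> uij tj; rewrite mxE; apply/eqP/prodf_eq0; exists i => //.
by apply/prodf_eq0; exists j => //; rewrite uij expf_eq0 tj eqxx.
Qed.

(** The image of the product of the coordinate subspaces given by [E]; the pairs
    are natural numbers, which avoids index types depending on the factor. *)
Definition coordinate_stratum (E : nat -> nat -> bool) : set (proj_space F N) :=
  [set p | exists u : point, [/\ forall i, u i != 0, val p = <[sv_map d u]>%VS
    & forall i (j : 'I_(tnth n i).+1), E i j -> u i 0 j = 0]].

Lemma coordinate_stratum_closed E :
  exists C, zariski_closed C /\
    coordinate_stratum E = segre_veronese F n d `&` C.
Proof.
pose S : set {mpoly F[N.+1]} := [set f | exists (k : 'I_N.+1) i (j : 'I_(tnth n i).+1),
  [/\ E i j, (0 < tnth (val (sv_coord k i)) j)%N & f = 'X_k]].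
exists [set p | forall f, S f -> vanishes_at f p]; split.
  exists S; split=> // f [k [i [j [_ _ ->]]]]; exists 1%N.
  by rewrite dhomogX /= mdeg1.
apply/seteqP; split=> p /=.
  move=> [u [u0 pu uE]]; split; first by exists u.
  move=> f [k [i [j [Eij tj ->]]]] v; rewrite pu => /vlineP[c ->].
  by rewrite mevalXU mxE (sv_map_coord0 (uE i j Eij) tj) mulr0.
move=> [[u [u0 pu]] H]; exists u; split=> // i j Eij.
apply/eqP; apply: contraT => uij.
have [k [uk tk]] := sv_coord_detects u0 uij.
have Sk : S 'X_k by exists k, i, j.
have := H _ Sk (sv_map d u); rewrite pu memv_line mevalXU => /(_ isT) /eqP.
by rewrite (negbTE uk).
Qed.

Lemma coordinate_stratum_sub (E E' : nat -> nat -> bool) :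
  (forall i j, E i j -> E' i j) ->
  coordinate_stratum E' `<=` coordinate_stratum E.
Proof. by move=> EE p [u [u0 pu uE]]; exists u; split=> // i j /EE; apply: uE. Qed.

(** The vectors with all entries outside [E] equal to 1 lie on no smaller
    stratum. *)
Lemma coordinate_stratum_witness (E : nat -> nat -> bool) :
  (forall i : 'I_r, exists j : 'I_(tnth n i).+1, ~~ E i j) ->
  exists p, coordinate_stratum E p /\
    forall (E' : nat -> nat -> bool) (i : 'I_r) (j : 'I_(tnth n i).+1),
    ~~ E i j -> E' i j -> ~ coordinate_stratum E' p.
Proof.
move=> H; pose u : point := fun i => \row_j (~~ E i j)%:R.
have u0 i : u i != 0.
  have [j Eij] := H i; apply: contraTneq (oner_neq0 F) => ui.
  rewrite negbK; apply/eqP.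
  by have := congr1 (fun x : 'rV_ _ => x 0 j) ui; rewrite !mxE Eij.
exists (point_of (sv_map_neq0 u0)); split.
  by exists u; split=> // i j Eij; rewrite mxE Eij.
move=> E' i j Eij E'ij [u' [u'0 /= eu u'E]].
have uij : u i 0 j != 0 by rewrite mxE Eij oner_neq0.
have [k [uk tk]] := sv_coord_detects u0 uij; move/eqP: uk; apply.
have : sv_map d u \in <[sv_map d u']>%VS by rewrite -eu memv_line.
by case/vlineP => c ->; rewrite mxE (sv_map_coord0 (u'E i j E'ij) tk) mulr0.
Qed.

Lemma coordinate_stratum_proper (E E' : nat -> nat -> bool)
    (i : 'I_r) (j : 'I_(tnth n i).+1) :
  (forall i j, E i j -> E' i j) -> ~~ E i j -> E' i j ->
  (forall i : 'I_r, exists j : 'I_(tnth n i).+1, ~~ E i j) ->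
  coordinate_stratum E' `<` coordinate_stratum E.
Proof.
move=> EE Eij E'ij H; split; first exact: coordinate_stratum_sub.
have [p [Ep Hp]] := coordinate_stratum_witness H.
by move=> sub; apply: (Hp E' i j) => //; apply: sub.
Qed.

(** Coordinates, as polynomials in the parameter, of the image of the segment
    from [u] to [u']. *)
Definition segment_poly u u' (k : 'I_N.+1) : {poly F} :=
  \prod_i \prod_(j < (tnth n i).+1)
    ((u i 0 j)%:P + (u' i 0 j - u i 0 j) *: 'X) ^+ tnth (val (sv_coord k i)) j.

Lemma segment_polyE u u' k x :
  (segment_poly u u' k).[x] = sv_map d (fun i => u i + x *: (u' i - u i)) 0 k.
Proof.
rewrite mxE horner_prod; apply: eq_bigr => i _.
rewrite horner_prod; apply: eq_bigr => j _.
by rewrite horner_exp hornerD hornerC hornerZ hornerX !mxE mulrC.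
Qed.

Lemma meval_segment (f : {mpoly F[N.+1]}) u u' : exists h : {poly F}, forall x,
  h.[x] = f.@[fun k => sv_map d (fun i => u i + x *: (u' i - u i)) 0 k].
Proof.
exists (\sum_(m <- msupp f) f@_m *: \prod_k segment_poly u u' k ^+ m k) => x.
rewrite mevalE horner_sum; apply: eq_bigr => m _; rewrite hornerZ horner_prod.
by congr (_ * _); apply: eq_bigr => k _; rewrite horner_exp segment_polyE.
Qed.

(** If [f] does not vanish at the image of [u] and [g] does not vanish at the
    image of [u'], then on the image of the segment from [u] to [u'] both
    restrict to nonzero polynomials of one variable, hence some point of it is
    outside both zero loci. *)
Lemma coordinate_stratum_irreducible (E : nat -> nat -> bool) :
  (forall i : 'I_r, exists j : 'I_(tnth n i).+1, ~~ E i j) ->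
  irreducible_set (coordinate_stratum E).
Proof.
move=> H; split; first by have [p [Ep _]] := coordinate_stratum_witness H; exists p.
move=> _ _ [S [Sh ->]] [S' [Sh' ->]] sub.
apply: contrapT => /not_orP[nA nB].
have pick G : ~ coordinate_stratum E `<=` [set p | forall f, G f -> vanishes_at f p] ->
    exists p f, [/\ coordinate_stratum E p, G f & ~ vanishes_at f p].
  move=> nG; apply: contrapT => nex; apply: nG => p Ep f Gf; apply: contrapT => nf.
  by apply: nex; exists p, f.
have [p [f [[u [u0 pu uE]] Sf fp]]] := pick _ nA.
have [q [g [[u' [u'0 qu u'E]] Sg gq]]] := pick _ nB.
have [df fh] := Sh f Sf; have [dg gh] := Sh' g Sg.
have [hf hfE] := meval_segment f u u'; have [hg hgE] := meval_segment g u u'.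
have [k uk] := nonzero_entry (sv_map_neq0 u0).
have at0 : (fun i => u i + 0 *: (u' i - u i)) = u.
  by apply: functional_extensionality_dep => i; rewrite scale0r addr0.
have at1 : (fun i => u i + 1 *: (u' i - u i)) = u'.
  by apply: functional_extensionality_dep => i; rewrite scale1r addrC subrK.
have hf0 : hf != 0.
  apply: contra_notN fp => /eqP hf0; apply/(vanishes_at_gen fh pu).
  by have := hfE 0; rewrite at0 hf0 horner0.
have hg0 : hg != 0.
  apply: contra_notN gq => /eqP hg0; apply/(vanishes_at_gen gh qu).
  by have := hgE 1; rewrite at1 hg0 horner0.
(* the third factor keeps the image vector from being zero *)
have hk0 : segment_poly u u' k != 0.
  apply: contraNneq uk => h0.
  by have := segment_polyE u u' k 0; rewrite at0 h0 horner0 => /esym/eqP.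
have [x] : exists x, (hf * hg * segment_poly u u' k).[x] != 0.
  by apply: poly_nonroot; rewrite !mulf_neq0.
rewrite !hornerM !mulf_eq0 !negb_or hfE hgE segment_polyE => /andP[/andP[fx gx] kx].
pose ux : point := fun i => u i + x *: (u' i - u i).
have sx : sv_map d ux != 0 by apply: contraNneq kx; rewrite /ux => ->; rewrite mxE.
have Ex : coordinate_stratum E (point_of sx).
  exists ux; split=> //; first by move: sx; rewrite sv_map_eq0 => /existsPn.
  by move=> i j Eij; rewrite /ux !mxE uE // u'E // subrr mulr0 addr0.
have px : val (point_of sx) = <[sv_map d ux]>%VS by [].
case: (sub _ Ex) => /= [/(_ f Sf)|/(_ g Sg)].
  by move/(vanishes_at_gen fh px)/eqP; apply/negP.
by move/(vanishes_at_gen gh px)/eqP; apply/negP.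
Qed.

End SegreVeronese.

Section SVDimension.
Variables (F : numFieldType) (r : nat) (n d : r.-tuple nat).
Hypothesis d_gt0 : forall i, (0 < tnth d i)%N.

(** All coordinates of the factors except the first one of each; killing them one
    after the other descends from the whole variety to a point. *)
Definition coordinate_flag : seq (nat * nat) :=
  [seq (nat_of_ord i, j.+1) | i <- enum 'I_r, j <- iota 0 (tnth n i)].

Lemma size_coordinate_flag : size coordinate_flag = (\sum_(i < r) tnth n i)%N.
Proof.
rewrite size_allpairs_dep sumnE big_map big_enum /=.
by apply: eq_bigr => i _; rewrite size_iota.
Qed.

(** The [m]-th member is where the coordinates of the flag from position [m] on
    vanish; the coordinate at position [m] tells it from the next member. *)
Lemma segre_veronese_chain :
  exists W, irreducible_chain (segre_veronese F n d) (\sum_(i < r) tnth n i) W.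
Proof.
pose s := coordinate_flag.
have s_uniq : uniq s.
  apply: allpairs_uniq_dep => [|i _|]; rewrite ?enum_uniq ?iota_uniq //.
  by move=> [i j] [i' j'] _ _ /= [/val_inj -> ->].
have sP m : (m < size s)%N -> exists (i : 'I_r) (j : 'I_(tnth n i).+1),
    nth (0, 0)%N s m = (nat_of_ord i, nat_of_ord j).
  move/(mem_nth (0, 0)%N) => /allpairsPdep[i [j [_ jn ->]]].
  by rewrite mem_iota add0n in jn; exists i, (Ordinal (jn : (j.+1 < (tnth n i).+1)%N)).
pose E m := fun i j : nat => (i, j) \in drop m s.
have E0 m (i : 'I_r) : exists j : 'I_(tnth n i).+1, ~~ E m i j.
  exists ord0; apply/negP => /mem_drop /allpairsPdep[? [? [_ _ []]]] //.
exists (fun m => @coordinate_stratum F r n d (E m)); split=> m mn.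
  split; first by apply: coordinate_stratum_irreducible.
  exact: coordinate_stratum_closed.
rewrite -size_coordinate_flag in mn; have [i [j ij]] := sP m mn.
have dropE := drop_nth (0, 0)%N mn.
apply: (@coordinate_stratum_proper F r n d d_gt0 (E m.+1) (E m) i j) => //.
- by move=> i' j'; rewrite /E dropE inE orbC => ->.
- rewrite /E -ij; have := drop_uniq m s_uniq.
  by rewrite dropE cons_uniq => /andP[].
- by rewrite /E dropE ij mem_head.
Qed.

End SVDimension.

(** * Secant varieties of SV^(1,1,2)_(1,e,1) *)

Section SecantBound.
Variables (F : fieldType) (k l h : nat).
Hypothesis h_lt : (h < 2 * k.+1)%N.
Local Notation e := (k + l)%N.
Local Notation n := [tuple 1%N; 1%N; 2%N].
Local Notation d := [tuple 1%N; e; 1%N].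
Local Notation N := (sv_ambient_dim n d).

Lemma linear_monomial m (t : monomial m 1) : exists j, forall x : 'rV[F]_m.+1,
  \prod_i x 0 i ^+ tnth (val t) i = x 0 j.
Proof.
have t1 := monomial_sum t.
have /existsP[j tj] : [exists j, (0 < tnth (val t) j)%N].
  apply: contra_eqT t1 => /existsPn t0.
  by rewrite big1 // => j _; apply/eqP; rewrite eqn0Ngt t0.
exists j => x; rewrite (bigD1 j) //=; move: t1; rewrite (bigD1 j) //=.
case: (nat_of_ord _) tj => [//|[|//]] _.
rewrite add1n => -[/eqP]; rewrite sum_nat_eq0 => /forallP t0.
by rewrite expr1 big1 ?mulr1 // => i ij; have := t0 i; rewrite ij => /eqP ->.
Qed.

Lemma binary_monomial m (t : monomial 1 m) : exists2 s, (s <= m)%N &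
  forall x : 'rV[F]_2,
    \prod_i x 0 i ^+ tnth (val t) i = x 0 0 ^+ (m - s) * x 0 1 ^+ s.
Proof.
have := monomial_sum t; rewrite big_ord_recl big_ord1 => tm.
exists (tnth (val t) (lift ord0 ord0)) => [|x]; first by rewrite -[X in (_ <= X)%N]tm leq_addl.
rewrite big_ord_recl big_ord1; congr (_ ^+ _ * _ ^+ _).
  by rewrite -[X in (X - _)%N]tm addnK.
by congr (x 0 _); apply: val_inj.
Qed.

(** The coordinates of [sv_map], indexed by the exponent of the second variable
    in the middle factor instead of by monomials. *)
Definition sv_entry (u : forall i : 'I_3, 'rV[F]_(tnth n i).+1)
    (i : 'I_2) (s : nat) (j : 'I_3) : F :=
  (u ord0 : 'rV_2) 0 i *
  ((u (lift ord0 ord0) : 'rV_2) 0 0 ^+ (e - s) * (u (lift ord0 ord0) : 'rV_2) 0 1 ^+ s) *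
  (u (lift ord0 (lift ord0 ord0)) : 'rV_3) 0 j.

Lemma sv_map_entry (a : 'I_N.+1) : exists isj : 'I_2 * nat * 'I_3,
  (isj.1.2 <= e)%N /\ forall u, sv_map d u 0 a = sv_entry u isj.1.1 isj.1.2 isj.2.
Proof.
have [i iE] := @linear_monomial 1 (sv_coord a ord0).
have [s se sE] := @binary_monomial e (sv_coord a (lift ord0 ord0)).
have [j jE] := @linear_monomial 2 (sv_coord a (lift ord0 (lift ord0 ord0))).
exists (i, s, j); split=> // u.
have prod3 (G : 'I_3 -> F) :
    \prod_i G i = G ord0 * G (lift ord0 ord0) * G (lift ord0 (lift ord0 ord0)).
  by rewrite !big_ord_recl big_ord0 mulr1 mulrA.
by rewrite mxE prod3; congr (_ * _ * _); [apply: iE|apply: sE|apply: jE].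
Qed.

(** Pairs of a tensor and a curve of bidegree (1,k) whose multiples by the
    monomials of degree l annihilate it.  The index [ib] gives the last nonzero
    coefficient of one row of the curve, and this coefficient is 1. *)
Definition normalized_syzygy (ib : 'I_2 * 'I_k.+1) : Type :=
  {Tx : ('I_2 -> nat -> 'I_3 -> F) * ('I_2 -> 'I_k.+1 -> F) |
    [/\ Tx.2 ib.1 ib.2 = 1, forall b : 'I_k.+1, (ib.2 < b)%N -> Tx.2 ib.1 b = 0
      & forall c j, (c <= l)%N ->
          \sum_i \sum_(b < k.+1) Tx.2 i b * Tx.1 i (b + c)%N j = 0]}.

(** Normalization saves one coefficient: in row [ib.1] those from [ib.2 <= k] on
    are fixed, so indices below [k] suffice there. *)
Definition free_coef ib (y : 'I_k + 'I_k.+1) (x : normalized_syzygy ib) : F :=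
  match y with
  | inl b => (sval x).2 ib.1 (widen_ord (leqnSn k) b)
  | inr b => (sval x).2 (rev_ord ib.1) b
  end.

(** The entries that the relations leave free: the other row, and in row [ib.1]
    those outside the window [ib.2, ib.2 + l]. *)
Definition free_entry ib (y : ('I_e.+1 + 'I_k) * 'I_3) (x : normalized_syzygy ib) : F :=
  match y.1 with
  | inl s => (sval x).1 (rev_ord ib.1) s y.2
  | inr s => (sval x).1 ib.1 (if (s < ib.2)%N then s : nat else (s + l).+1) y.2
  end.

Lemma sum_rev_ord (i0 : 'I_2) (G : 'I_2 -> F) : \sum_i G i = G i0 + G (rev_ord i0).
Proof.
rewrite (bigD1 i0) //=; congr (_ + _); apply: big_pred1 => i.
by case: i0 i => [[|[|//]] ?] [[|[|//]] ?].
Qed.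

(** The relation with [c = s - ib.2] has leading term T(i,s,j), whose coefficient
    is 1, and otherwise involves row [ib.1] only at smaller indices.  Each
    substitution raises the degree in the coefficients by one, whence the bound
    [s.+1]; the degree in the free entries stays 1. *)
Lemma syzygy_entry_bigraded ib s i j : (s <= e)%N ->
  bigraded (@free_coef ib) (@free_entry ib) s.+1 1 (fun x => (sval x).1 i s j).
Proof.
move=> se.
have other s' m : (s' <= e)%N ->
    bigraded (@free_coef ib) (@free_entry ib) m 1
      (fun x => (sval x).1 (rev_ord ib.1) s' j).
  move=> s'e; pose y : ('I_e.+1 + 'I_k) * 'I_3 :=
    (inl (Ordinal (s'e : (s' < e.+1)%N)), j).
  exact: (bigraded_w (@free_coef ib) (@free_entry ib) m y).
have [->|ii] := eqVneq i (rev_ord ib.1); first exact: other.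
have {i ii} -> : i = ib.1.
  by apply: val_inj; case: ib.1 i ii {other} => [[|[|//]] ?] [[|[|//]] ?].
case: ib other => i b0 /= other.
elim/ltn_ind: s se => s IH se.
have b0k : (b0 <= k)%N by rewrite -ltnS.
have [sb|bs] := ltnP s b0.
  pose y : ('I_e.+1 + 'I_k) * 'I_3 := (inr (Ordinal (leq_trans sb b0k)), j).
  have := bigraded_w (@free_coef (i, b0)) (@free_entry (i, b0)) s.+1 y.
  by apply: bigraded_ext => x; rewrite /free_entry /= sb.
have [sl|ls] := leqP s (b0 + l); last first.
  have yk : (s - l.+1 < k)%N by lia.
  pose y : ('I_e.+1 + 'I_k) * 'I_3 := (inr (Ordinal yk), j).
  have := bigraded_w (@free_coef (i, b0)) (@free_entry (i, b0)) s.+1 y.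
  apply: bigraded_ext => x; rewrite /free_entry /= ltnNge.
  have -> : (b0 <= s - l.+1)%N by lia.
  by congr ((sval x).1 i _ j) => /=; lia.
have cl : (s - b0 <= l)%N by lia.
have le_e (b : 'I_k.+1) : (b + (s - b0) <= e)%N by have := ltn_ord b; lia.
apply: (@bigraded_ext _ _ _ _ _ _ _ _ (fun x =>
   - (\sum_(b : 'I_k.+1 | (b < b0)%N)
        (sval x).2 i b * (sval x).1 i (b + (s - b0))%N j +
      \sum_(b : 'I_k.+1)
        (sval x).2 (rev_ord i) b * (sval x).1 (rev_ord i) (b + (s - b0))%N j))).
  move=> x; have [/= x1 x0 /(_ (s - b0)%N j cl)] := svalP x.
  rewrite (sum_rev_ord i) (bigID (fun b : 'I_k.+1 => (b < b0)%N)) /=.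
  rewrite [X in _ + X + _](bigD1 b0) ?ltnn //= x1 mul1r subnKC //.
  rewrite [X in _ + (_ + X) + _]big1 => [|b /andP[]]; last first.
    rewrite -leqNgt => b0b bb0; rewrite x0 ?mul0r // ltn_neqAle b0b andbT.
    by rewrite eq_sym -val_eqE in bb0.
  rewrite addr0 addrAC => /eqP; rewrite addr_eq0 => /eqP ->.
  by rewrite opprK.
apply: bigradedN; apply: bigradedD; apply: bigraded_sum => b.
  move=> bb; have bk : (b < k)%N by apply: leq_trans bb b0k.
  have blt : (b + (s - b0) < s)%N by lia.
  have := bigradedM (bigraded_u (@free_coef (i, b0)) (@free_entry (i, b0))
      (inl (Ordinal bk)) (ltn0Sn 0)) (IH _ blt (le_e b)).
  move/(bigraded_le (m' := s.+1)); rewrite add1n ltnS blt => /(_ isT).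
  apply: bigraded_ext => x; congr (_ * _); rewrite /free_coef /=.
  by congr (_ i _); apply: val_inj.
move=> _.
have := bigradedM (bigraded_u (@free_coef (i, b0)) (@free_entry (i, b0))
      (inr b) (ltn0Sn 0)) (other _ s (le_e b)).
by rewrite add1n.
Qed.

(** The [h] points of P^1 x P^1 impose [h < 2k+2] linear conditions on the curves
    of bidegree (1,k), so some curve passes through all of them; its multiples
    annihilate each summand and hence the sum. *)
Lemma rank_one_sum_syzygy (c : 'I_h -> F)
    (u : 'I_h -> forall i : 'I_3, 'rV[F]_(tnth n i).+1) :
  exists ib (x : normalized_syzygy ib), forall i s j,
    (sval x).1 i s j = \sum_m c m * sv_entry (u m) i s j.
Proof.
pose A (ib : 'I_2 * 'I_k.+1) m := (u m ord0 : 'rV_2) 0 ib.1 *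
  ((u m (lift ord0 ord0) : 'rV_2) 0 0 ^+ (k - ib.2) *
   (u m (lift ord0 ord0) : 'rV_2) 0 1 ^+ ib.2).
have [|z [[[i0 b1] zi0] zA]] := @exists_relation F _ _ A.
  by rewrite card_prod !card_ord.
case: (arg_maxnP (fun b : 'I_k.+1 => b : nat) (zi0 : (fun b => z (i0, b) != 0) b1)).
move=> b0 zb0 b0max.
pose Tx : ('I_2 -> nat -> 'I_3 -> F) * ('I_2 -> 'I_k.+1 -> F) :=
  (fun i s j => \sum_m c m * sv_entry (u m) i s j,
   fun i b => z (i, b) / z (i0, b0)).
unshelve eexists (i0, b0), (exist _ Tx _) => //.
split=> /= [|b b0b|a j al]; first by rewrite mulfV.
  suff /eqP -> : z (i0, b) == 0 by rewrite mul0r.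
  by apply: contraLR b0b => /b0max; rewrite -leqNgt.
pose G m := c m * ((u m (lift ord0 ord0) : 'rV_2) 0 0 ^+ (l - a) *
  (u m (lift ord0 ord0) : 'rV_2) 0 1 ^+ a *
  (u m (lift ord0 (lift ord0 ord0)) : 'rV_3) 0 j) / z (i0, b0).
transitivity (\sum_m G m * \sum_ib z ib * A ib m); last first.
  by rewrite big1 // => m _; rewrite zA mulr0.
rewrite pair_bigA /=.
under eq_bigr do rewrite mulr_sumr.
under [RHS]eq_bigr do rewrite mulr_sumr.
rewrite [RHS]exchange_big /=; apply: eq_bigr => -[i b] _ /=.
apply: eq_bigr => m _; rewrite /sv_entry /G /A /=.
have -> : (e - (b + a) = (k - b) + (l - a))%N by have := ltn_ord b; lia.
by rewrite !exprD; ring.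
Qed.

(** The parameters are 2k+1 coefficients and 3(e+1+k) entries, so this is
    [chain_length_le] with (2k+1) + (3(e+1+k) - 1) = 3e+5k+3. *)
Theorem secant_chain_length_le m W :
  irreducible_chain (secant_variety h (segre_veronese F n d)) m W ->
  (m <= 3 * e + 5 * k + 3)%N.
Proof.
have /choice[q qP] := sv_map_entry.
have := @chain_length_le F N (secant_variety h (segre_veronese F n d)) _ normalized_syzygy
  (fun ib x => \row_a (sval x).1 (q a).1.1 (q a).1.2 (q a).2)
  _ _ free_coef free_entry e.+1.
rewrite card_prod !card_sum !card_ord => H chW.
apply: leq_trans (H _ _ _ _ _ chW) _; [by lia| | |by lia].
  move=> ib a; have [qe _] := qP a.
  apply: bigraded_ext (bigraded_le _ (syzygy_entry_bigraded _ _ _ qe)) => [x|].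
    by rewrite mxE.
  by rewrite ltnS.
move=> t g gt g0 p0 /(_ _ (zero_locus_closed gt)); apply=> p [y [yX py]] v pv.
have /choice[u uP] := yX.
have : v \in (\sum_(i < h) val (y i))%VS by apply: (subvP py).
case/memv_sumP => vs vsy ->.
have /choice[c cP] : forall i, exists c, vs i = c *: sv_map d (u i).
  move=> i; have := vsy i isT; have [_ ->] := uP i.
  by case/vlineP => c ->; exists c.
have [ib [x xE]] := rank_one_sum_syzygy c u.
rewrite -(g0 ib x); apply: meval_eq => a; rewrite !mxE summxE xE.
by apply: eq_bigr => i _; rewrite cP mxE; have [_ ->] := qP a.
Qed.

End SecantBound.

(** * Defectivity *)

Lemma secant_variety_nonempty (F : fieldType) N (X : set (proj_space F N)) m :
  (0 < m)%N -> X !=set0 -> secant_variety m X !=set0.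
Proof.
move=> m0 [p Xp]; exists p => Z _; apply; exists (fun _ => p); split=> //.
by apply: (sumv_sup (Ordinal m0)).
Qed.

Section Defect.
Variables (F : numFieldType) (k l h : nat).
Local Notation n := [tuple 1%N; 1%N; 2%N].

Lemma sv_ambient_dimE e : sv_ambient_dim n [tuple 1%N; e; 1%N] = (6 * e + 5)%N.
Proof.
rewrite /sv_ambient_dim !big_ord_recl big_ord0 /= !(tnth_nth 0%N) /=.
by rewrite !bin1 add1n binSn; lia.
Qed.
(** The dimension of the Segre-Veronese variety enters only through the lower
    bound 4, since the expected dimension increases with it. *)
Theorem segre_veronese_defective e : e = (k + l)%N -> (0 < e)%N ->
  (0 < h < 2 * k.+1)%N ->
  (3 * e + 5 * k + 3 < expected_secant_dim 4 h (6 * e + 5))%N ->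
  defective h (segre_veronese F n [tuple 1%N; e; 1%N]).
Proof.
move=> ekl e0 /andP[h0 hk] lt_dim; pose X := segre_veronese F n [tuple 1%N; e; 1%N].
have d_gt0 i : (0 < tnth [tuple 1%N; e; 1%N] i)%N.
  by rewrite (tnth_nth 0%N); case: i => [[|[|[|]]]].
have [W chW] := segre_veronese_chain F n d_gt0.
rewrite !big_ord_recl big_ord0 /= in chW.
have [p Xp] : X !=set0.
  have [/(_ 0%N isT) [[[p Wp] _] [C [_ WC]]] _] := chW.
  by exists p; move: Wp; rewrite WC => -[].
have [m Xm _] := has_dim_exists (ex_intro _ p Xp) (@chain_length_le_ambient _ _ X).
have [s Xs sb] : exists2 s, has_dim (secant_variety h X) s & (s <= 3 * e + 5 * k + 3)%N.
  apply: has_dim_exists; first by apply: secant_variety_nonempty => //; exists p.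
  move=> m' W'; rewrite /X; clear -hk ekl; subst e; exact: secant_chain_length_le.
exists m, s; split=> //; rewrite sv_ambient_dimE.
have m4 : (4 <= m)%N by apply: (proj2 Xm) chW.
rewrite (leq_ltn_trans sb) // (leq_trans lt_dim) // /expected_secant_dim.
have : (4 * h <= m * h)%N by rewrite leq_mul2r m4 orbT.
lia.
Qed.
End Defect.

Local Close Scope ring_scope.
Local Close Scope classical_set_scope.

Theorem proposition6p3 (R : realType) (a : nat) :
  defective (6 * a + 5)
    (segre_veronese R[i] [tuple 1; 1; 2] [tuple 1; 5 * a + 3; 1]) /\
  defective (6 * a + 7)
    (segre_veronese R[i] [tuple 1; 1; 2] [tuple 1; 5 * a + 5; 1]).
Proof.
split.
- by apply: (@segre_veronese_defective _ (3 * a + 2) (2 * a + 1));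
    rewrite ?/expected_secant_dim; lia.
- by apply: (@segre_veronese_defective _ (3 * a + 3) (2 * a + 2));
    rewrite ?/expected_secant_dim; lia.
Qed.
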